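(* For each integer $n\ge1$, let $M_n=\{\{(0,k),(1,k)\}\mid 1\le k\le n\}$, let $\Gamma_n$ be the set of graphs $G\subseteq\{\{(0,k),(1,l)\}\mid 1\le k,l\le 2n\}$ that have $M_n$ as a maximum cardinality matching, and let $\Pi_n=\mathcal S(\{(1,k)\mid 1\le k\le 2n\})$. Let $$Q_n=\min_{(G,\pi)\in\Gamma_n\times\Pi_n}\frac{\mathbb{E}_{R\sim\mathrm{RANKING}(G,\pi)}\bigl[|R|\bigr]}{|M_n|},$$ where the offline vertex set used by RANKING is $V_n=\{(0,k)\mid 1\le k\le 2n\}$. If the sequence $(Q_n)_n$ converges, then $Q_n$ tends to $1-1/e$ as $n\to\infty$.
   Context: An edge is a set of exactly two vertices; a graph $G$ is a set of edges; $\mathcal V(G)=\bigcup_{e\in G}e$ and $N_G(v)=\{u\mid\{v,u\}\in G\}$. A matching is a set of pairwise disjoint edges; a matching $M\subseteq G$ is a maximum cardinality matching with respect to $G$ if no matching contained in $G$ has larger cardinality. A permutation of a finite set $A$ is a list of distinct elements whose elements are exactly those of $A$; $\mathcal S(A)$ is the set of permutations of $A$. For a list $\sigma$ of distinct elements, $\sigma(v)$ is the rank (position, starting at 1) of $v$ in $\sigma$. The procedure online-match$(G,\pi,\sigma)$: start with $R=\emptyset$; process the vertices $u$ of $\pi$ in order; if $N_G(u)\setminus\mathcal V(R)\neq\emptyset$, add to $R$ the edge $\{v,u\}$, where $v$ is the vertex of $N_G(u)\setminus\mathcal V(R)$ with minimum rank $\sigma(v)$; otherwise leave $R$ unchanged.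 The output is the final $R$. $\mathrm{RANKING}(G,\pi)$, with offline vertex set $V$, is the probability distribution of online-match$(G,\pi,\sigma)$ when $\sigma$ is drawn uniformly at random from $\mathcal S(V)$. *)

(* Defs.v *)
From mathcomp Require Import all_boot all_order all_algebra.
From mathcomp Require Import all_classical all_reals all_analysis.
(* Last, so that set0, trivIset, ... are those of finset rather than those of
   classical_sets. *)
From mathcomp Require Import finset.

Set Implicit Arguments.
Unset Strict Implicit.
Unset Printing Implicit Defensive.

Import Order.TTheory GRing.Theory Num.Theory.
Local Open Scope ring_scope.

Section Graphs.
Variable T : finType.
Implicit Types (G M R : {set {set T}}) (A V : {set T}) (s pi sigma : seq T).

Definition is_graph G : bool := [forall e in G, #|e| == 2%N].

Definition vertices G : {set T} := \bigcup_(e in G) e.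

Definition neighbours G (v : T) : {set T} := [set u | [set v; u] \in G].

Definition matching M : bool := is_graph M && trivIset M.

Definition max_card_matching G M : bool :=
  [&& matching M, M \subset G &
      [forall M' : {set {set T}},
         (matching M' && (M' \subset G)) ==> (#|M'| <= #|M|)%N]].

(* Duplicate-free list of all permutations of A. *)
Definition perms_of A : seq (seq T) := permutations (enum A).

Definition rank sigma (v : T) : nat := (index v sigma).+1.

(* [v0] only witnesses that the set of free neighbours is nonempty; the
   minimiser does not depend on it as soon as sigma lists these neighbours. *)
Definition match_step G sigma R (u : T) : {set {set T}} :=
  let N := neighbours G u :\: vertices R in
  if [pick v in N] is Some v0
  then [set [arg min_(v < v0 in N) rank sigma v]; u] |: R
  else R.

Definition online_match G pi sigma : {set {set T}} :=
  foldl (match_step G sigma) set0 pi.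

End Graphs.

Section Ranking.
Variables (K : realType) (T : finType).
Implicit Types (G M : {set {set T}}) (V : {set T}) (pi : seq T).

(* Probability mass function of the output when sigma is uniform on the
   permutations of the offline set V. *)
Definition RANKING V G pi : {ffun {set {set T}} -> K} :=
  [ffun M => (count [pred sigma | online_match G pi sigma == M] (perms_of V))%:R
             / (size (perms_of V))%:R].

Definition pmf_expectation (P : {ffun {set {set T}} -> K})
    (X : {set {set T}} -> K) : K :=
  \sum_M P M * X M.

End Ranking.

(* Minimum of a nonempty list (0 on the empty list). *)
Definition seq_min (K : realType) (s : seq K) : K :=
  \big[Num.min/head 0 s]_(x <- s) x.

Section Instances.
Variable n : nat.

(* (i, k) stands for the vertex (i, k + 1): second components are numbered from
   0 to 2n - 1 instead of from 1 to 2n. *)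
Definition vertex : finType := ('I_2 * 'I_(2 * n))%type.

Definition off_vertex (k : 'I_(2 * n)) : vertex := (0, k).

Definition on_vertex (k : 'I_(2 * n)) : vertex := (1, k).

Definition offline : {set vertex} := [set off_vertex k | k : 'I_(2 * n)].

Definition online : {set vertex} := [set on_vertex k | k : 'I_(2 * n)].

Definition all_edges : {set {set vertex}} :=
  [set [set off_vertex k; on_vertex l] | k : 'I_(2 * n), l : 'I_(2 * n)].

Definition diag_matching : {set {set vertex}} :=
  [set [set off_vertex k; on_vertex k] | k : 'I_(2 * n) & (k < n)%N].

Definition Gamma : {set {set {set vertex}}} :=
  [set G in powerset all_edges | max_card_matching G diag_matching].

Definition Pi : seq (seq vertex) := perms_of online.

Definition competitive_ratio (K : realType)
    (G : {set {set vertex}}) (pi : seq vertex) : K :=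
  pmf_expectation (RANKING K offline G pi) (fun R => #|R|%:R)
  / #|diag_matching|%:R.

End Instances.

(* Meaningful for n >= 1; the value at n = 0 is irrelevant to limits. *)
Definition Q (K : realType) (n : nat) : K :=
  seq_min [seq competitive_ratio K G pi | G <- enum (Gamma n), pi <- Pi n].

(* Main.v *)
(* For every n >= 1, with m = 2n offline vertices,
     1 - (m/(m+1))^m <= Q_n <= 1 - 1/e + 2/n,
   and both bounds tend to 1 - 1/e.

   Lower bound (Birnbaum-Mathieu): let x_t be the probability that the vertex of
   rank t is matched, and move a uniformly random vertex v of the matching M_n to
   rank t.  If v is then unmatched, its M_n-partner is matched, wherever v was
   before, to a vertex of rank at most t; hence n <= m x_t + sum_(s <= t) x_s.
   Working with the rank among all m offline vertices, instead of the n matched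
   ones, avoids any reduction to graphs with a perfect matching.

   Upper bound: in the triangular graph where the i-th online vertex sees the
   offline vertices i, ..., n - 1, these are exchangeable up to time i, so each is
   taken at time i with the same probability q_i <= 1/(n - i).  Vertex w is thus
   matched with probability at most min(1, sum_(i <= w) 1/(n - i)), and the sum of
   these bounds over w is about n (1 - 1/e). *)

Require Import Defs.
From mathcomp Require Import all_boot all_order all_algebra all_fingroup.
From mathcomp Require Import all_classical all_reals all_analysis.
From mathcomp Require Import fintype finset.
From mathcomp Require Import zify ring lra.

Set Implicit Arguments.
Unset Strict Implicit.
Unset Printing Implicit Defensive.

Import Order.TTheory GRing.Theory Num.Theory.
Import numFieldNormedType.Exports.

(** * The greedy process *)

Section Greedy.
Variable m : nat.
Implicit Types (p : 'S_m) (A F : {set 'I_m}) (s : seq {set 'I_m}).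

(* Offline vertices are numbered by 'I_m; p k is the rank, from 0, of vertex k. *)
Definition best p A : option 'I_m :=
  [pick k in A | [forall j in A, p k <= p j]].

Lemma bestP p A k :
  reflect (k \in A /\ forall j, j \in A -> p k <= p j) (best p A == Some k).
Proof.
apply: (iffP eqP) => [|[kA kmin]]; rewrite /best; case: pickP => //.
- by move=> x /andP[xA /forall_inP xmin] [<-].
- move=> x /andP[xA /forall_inP xmin]; congr Some; apply/(@perm_inj _ p)/val_inj/eqP.
  by rewrite eqn_leq /= xmin // kmin.
by move=> /(_ k); rewrite kA /=; case/negP; apply/forall_inP.
Qed.

Lemma best_in p A x : x \in A -> exists2 k, best p A = Some k & p k <= p x.
Proof.
move=> xA; case: (arg_minnP (fun j => p j : nat) xA) => k kA kmin.
by exists k; [apply/eqP/bestP; split|exact: kmin].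
Qed.

Definition greedy_step p F A : {set 'I_m} :=
  if best p (A :&: F) is Some k then F :\ k else F.

(* The offline vertices left free when s lists the neighbourhoods of the online
   vertices in order of arrival. *)
Definition greedy p s : {set 'I_m} := foldl (greedy_step p) [set: 'I_m] s.

(* The offline vertex taken by the i-th arrival, if any. *)
Definition mate p s i : option 'I_m :=
  best p (nth set0 s i :&: greedy p (take i s)).

Lemma greedy_rcons p s A :
  greedy p (rcons s A) = greedy_step p (greedy p s) A.
Proof. by rewrite /greedy foldl_rcons. Qed.

Lemma greedy_take p s i : i < size s ->
  greedy p (take i.+1 s) = if mate p s i is Some k
    then greedy p (take i s) :\ k else greedy p (take i s).
Proof. by move=> lti; rewrite (take_nth set0 lti) greedy_rcons. Qed.

Lemma greedy_takeS p s i : greedy p s \subset greedy p (take i s).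
Proof.
elim/last_ind: s => [|s A IHs]; first by [].
have [lei|] := leqP i (size s).
  rewrite -[in X in _ \subset X]cats1 take_cat.
  have -> : (if i < size s then take i s else s ++ take (i - size s) [:: A]) = take i s.
    by case: ltngtP lei => // -> _; rewrite subnn take0 cats0 take_size.
  apply: subset_trans IHs; rewrite greedy_rcons /greedy_step.
  by case: best => // k; rewrite subD1set.
by move=> gti; rewrite take_oversize // size_rcons.
Qed.

(** Each vertex leaves the free set at most once, at the arrival that takes it, so the sum is 0 or
    1. This trades sums over matched vertices for sums over arrivals. *)
Lemma notin_greedy p s w :
  (w \notin greedy p s) = \sum_(i < size s) (mate p s i == Some w) :> nat.
Proof.
elim/last_ind: s => [|s A IHs]; first by rewrite big_ord0 inE.
rewrite size_rcons big_ord_recr /=.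
under eq_bigr => i _.
  have -> : mate p (rcons s A) i = mate p s i.
    by rewrite /mate nth_rcons ltn_ord -cats1 takel_cat // ltnW.
  over.
rewrite -IHs /mate nth_rcons ltnn eqxx -cats1 take_size_cat // cats1.
rewrite greedy_rcons /greedy_step; case E: best => [k|] /=; last by rewrite addn0.
have /bestP[/setIP[_ kF] _] := introT eqP E.
rewrite !inE negb_and negbK (inj_eq Some_inj) eq_sym.
by have [<-|] := eqVneq k w; [rewrite kF|rewrite addn0].
Qed.

Lemma card_matched p s :
  #|~: greedy p s| = \sum_(w : 'I_m) (w \notin greedy p s).
Proof. by rewrite -sum1_card -big_mkcond /=; apply: eq_bigl => w; rewrite inE. Qed.

(* If v stays free under p', then the run under p differs from it only by one
   extra free vertex, initially v: whenever the extra vertex is taken, the vertex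
   it displaces becomes the new extra one. *)
Lemma greedy_compare p p' v s :
  (forall j k, j != v -> k != v -> (p j <= p k) = (p' j <= p' k)) ->
  v \in greedy p' s ->
  greedy p' s :\ v \subset greedy p s /\
  exists w, greedy p s \subset w |: (greedy p' s :\ v).
Proof.
move=> eqpp'; elim/last_ind: s => [_|s A IHs].
  split; first exact: subsetT.
  by exists v; apply/subsetP => x _; rewrite !inE andbT orbN.
rewrite !greedy_rcons => vin.
have vF' : v \in greedy p' s.
  by move: vin; rewrite /greedy_step; case: best => // k; rewrite !inE => /andP[].
have [/subsetP sub [w /subsetP supw]] := IHs vF'.
move: {IHs} vin; rewrite /greedy_step.
set F := greedy p s in sub supw *; set F' := greedy p' s in sub supw vF' *.
case E': (best p' (A :&: F')) => [x|].
  have /bestP[/setIP[xA xF'] xmin] := introT eqP E'.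
  rewrite !inE => /andP[vNx _].
  have xF : x \in F by apply: sub; rewrite !inE eq_sym vNx.
  have [|y E yx] := @best_in p (A :&: F) x; first by rewrite inE xA.
  rewrite E; have /bestP[/setIP[yA yF] ymin] := introT eqP E.
  have [<-|yNx] := eqVneq y x.
    split; first by apply/subsetP => z; rewrite !inE => /and3P[zv zy zF'];
      rewrite zy sub // !inE zv.
    exists w; apply/subsetP => z; rewrite !inE => /andP[zy /supw].
    by rewrite !inE zy.
  (* Here the two runs take different vertices. Since [y] precedes [x] under [p], a free [y] other
     than [v] would also have been preferred under [p']. So [y] is the extra vertex [w], and [x],
     still free under [p], takes over that role. *)
  have yNF' : y \notin F' :\ v.
    apply/negP; rewrite !inE => /andP[yNv yF'].
    have: p' x <= p' y by rewrite xmin // inE yA.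
    rewrite -eqpp' // 1?eq_sym // => xy; case/eqP: yNx.
    by apply/(@perm_inj _ p)/val_inj/eqP; rewrite eqn_leq yx.
  have yw : y = w by have := supw _ yF; rewrite inE (negPf yNF') orbF inE => /eqP.
  split.
    apply/subsetP => z; rewrite !inE => /and3P[zv zx zF'].
    rewrite sub ?inE ?zv // andbT; apply: contraNneq yNF' => <-.
    by rewrite !inE zv.
  exists x; apply/subsetP => z; rewrite !inE => /andP[zy /supw].
  by rewrite -yw !inE (negPf zy) /=; case: (eqVneq z x).
move=> _; case E: best => [y|]; last by split; [exact/subsetP|exists w; exact/subsetP].
have /bestP[/setIP[yA yF] ymin] := introT eqP E.
have yNF' : y \notin F'.
  apply/negP => yF'; have [|k] := @best_in p' (A :&: F') y; first by rewrite inE yA.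
  by rewrite E'.
split; last by exists w; apply/subsetP => z; rewrite !inE => /andP[_ /supw]; rewrite !inE.
apply/subsetP => z zF'; rewrite !inE sub // andbT; apply: contraNneq yNF' => <-.
by case/setD1P: zF'.
Qed.

Lemma mate_compare p p' v s i :
  (forall j k, j != v -> k != v -> (p j <= p k) = (p' j <= p' k)) ->
  v \in greedy p' s -> i < size s -> v \in nth set0 s i ->
  exists x y, [/\ x != v, p' x < p' v, mate p s i = Some y & p y <= p x].
Proof.
move=> eqpp' vF' lti vA.
have vFi := subsetP (greedy_takeS p' s i) _ vF'.
have vFi1 := subsetP (greedy_takeS p' s i.+1) _ vF'.
have [|x mx xv] := @best_in p' (nth set0 s i :&: greedy p' (take i s)) v.
  by rewrite inE vA.
have /bestP[/setIP[xA xF'] _] := introT eqP mx.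
have xNv : x != v.
  by move: vFi1; rewrite greedy_take // /mate mx !inE eq_sym => /andP[].
have [/subsetP sub _] := greedy_compare eqpp' vFi.
have [|y my yx] := @best_in p (nth set0 s i :&: greedy p (take i s)) x.
  by rewrite inE xA sub // !inE xNv.
exists x, y; split=> //; rewrite ltn_neqAle xv andbT.
by apply: contra xNv => /eqP/val_inj/perm_inj ->.
Qed.

End Greedy.

(** * Moving one vertex *)

(** A ranking amounts to a place [j] for [v] and a ranking [q] of the other vertices; injectivity
    suffices because the cardinals agree. *)
Lemma lift_perm_bij m (v : 'I_m.+1) :
  bijective (fun jq : 'I_m.+1 * 'S_m => lift_perm v jq.1 jq.2).
Proof.
apply: inj_card_bij; last by rewrite card_prod card_ord !card_Sn factS.
move=> [j q] [j' q'] /= /permP E; have := E v; rewrite !lift_perm_id => jj'.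
rewrite -{}jj' in E *; congr pair; apply/permP => k.
by have := E (lift v k); rewrite !lift_perm_lift => /lift_inj.
Qed.

Lemma sum_lift_perm m (v : 'I_m.+1) (f : 'S_m.+1 -> nat) j :
  \sum_(p : 'S_m.+1 | p v == j) f p = \sum_(q : 'S_m) f (lift_perm v j q).
Proof.
rewrite (reindex _ (onW_bij _ (lift_perm_bij v))) /=.
rewrite (eq_bigl (fun jq => (jq.1 == j) && true)) => [|jq]; last first.
  by rewrite lift_perm_id andbT.
rewrite -(pair_big (pred1 j) xpredT (fun i q => f (lift_perm v i q))) /=.
by rewrite big_pred1_eq.
Qed.

Lemma lift_perm_le m (v i j : 'I_m.+1) (q : 'S_m) x y : x != v -> y != v ->
  (lift_perm v i q x <= lift_perm v i q y) =
  (lift_perm v j q x <= lift_perm v j q y).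
Proof.
move=> xv yv; case: (unliftP v x) xv => [x' ->|->]; last by rewrite eqxx.
case: (unliftP v y) yv => [y' ->|->]; last by rewrite eqxx.
by rewrite !lift_perm_lift /= !leq_bump2.
Qed.

(** Moving [v] shifts every other rank by at most one; the strict inequality in [mate_compare]
    absorbs this unit. *)
Lemma lift_perm_leS m (v i j : 'I_m.+1) (q : 'S_m) x : x != v ->
  lift_perm v i q x <= (lift_perm v j q x).+1.
Proof.
case: (unliftP v x) => [x' ->|->]; last by rewrite eqxx.
by rewrite !lift_perm_lift /= /bump; lia.
Qed.

(** * Counting matched vertices by rank *)

Section LowerCount.
Variables (m : nat) (s : seq {set 'I_m}) (D : {set 'I_m}) (c : 'I_m -> nat).
Hypothesis c_inj : {in D &, injective c}.
Hypothesis c_lt : {in D, forall v, c v < size s}.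
Hypothesis c_mem : {in D, forall v, v \in nth set0 s (c v)}.

(** Here [c v] is the arrival time of the partner of [v]. By [notin_greedy] the right side is a sum
    over all arrivals; as [c] is injective on [D], the left side is its part over [c @: D]. *)
Lemma matched_partners (p : 'S_m) (t : nat) :
  \sum_(v in D) (if mate p s (c v) is Some w then p w <= t else false)
  <= \sum_(w | p w <= t) (w \notin greedy p s).
Proof.
under [leqRHS]eq_bigr do rewrite notin_greedy.
rewrite exchange_big /=.
have -> : \sum_(v in D) (if mate p s (c v) is Some w then p w <= t else false) =
  \sum_(v in D) \sum_(w | p w <= t) (mate p s (c v) == Some w).
  apply: eq_bigr => v _; case: mate => [w|]; last by rewrite big1.
  rewrite (big_mkcond (fun w => p w <= t)) (bigD1 w) //= eqxx big1 ?addn0.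
    by case: leqP.
  by move=> w' w'w; rewrite (inj_eq Some_inj) eq_sym (negPf w'w) if_same.
pose g i := \sum_(w | p w <= t) (mate p s i == Some w).
have [->|[v0 v0D]] := set_0Vmem D; first by rewrite big_set0.
have s0 : 0 < size s by apply: leq_ltn_trans (c_lt v0D).
case: (size s) s0 c_lt => // k _ ltk.
pose c' v : 'I_k.+1 := inord (c v).
have c'E v : v \in D -> c' v = c v :> nat by move=> vD; rewrite inordK // ltk.
rewrite (eq_bigr (fun v => g (c' v))); last by move=> v vD; rewrite c'E.
rewrite -(big_imset (fun i : 'I_k.+1 => g i)) /=; last first.
  by move=> v w vD wD /(congr1 val); rewrite /= !c'E //; apply: c_inj.
rewrite [leqRHS](bigID (mem (c' @: D))) /=; exact: leq_addr.
Qed.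

(* The Birnbaum-Mathieu inequality: if v is unmatched when placed at rank t,
   then wherever v is moved its partner is matched to a vertex of rank at most t. *)
Lemma rank_count (t : 'I_m) :
  #|D| * m`! <= m * (\sum_(p : 'S_m) \sum_(w | p w == t) (w \notin greedy p s))
  + \sum_(p : 'S_m) \sum_(w | p w <= t) (w \notin greedy p s).
Proof.
case: m s D c c_inj c_lt c_mem t matched_partners =>
  [|m'] s' D' c' inj lts memc t matched; first by case: t.
(* [U v] counts the rankings of the other vertices for which [v], placed at rank [t], stays free.
   Each yields [m'.+1] rankings, one per place of [v], to which [mate_compare] applies; the
   remaining ones, counted in [fixed], have [v] matched at rank [t]. *)
pose U v := \sum_(q : 'S_m') (v \in greedy (lift_perm v t q) s').
have moved v : v \in D' -> m'.+1 * U v <=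
    \sum_(p : 'S_m'.+1) (if mate p s' (c' v) is Some w then p w <= t else false).
  move=> vD; rewrite (partition_big (fun p : 'S_m'.+1 => p v) xpredT) //=.
  under eq_bigr do rewrite sum_lift_perm.
  have -> : m'.+1 * U v = \sum_(j < m'.+1) U v by rewrite sum_nat_const card_ord.
  apply: leq_sum => j _; apply: leq_sum => q _.
  case: (boolP (v \in _)) => // vin.
  have [|||x [y [xv xlt -> yx]]] := mate_compare (p := lift_perm v j q) _ vin (i := c' v).
  - by move=> x y; apply: lift_perm_le.
  - exact: lts.
  - exact: memc.
  rewrite lift_perm_id in xlt.
  suff -> : lift_perm v j q y <= t by [].
  by apply: leq_trans yx _; apply: leq_trans (lift_perm_leS j t q xv) xlt.
have fixed v : m'`! = U v + \sum_(p : 'S_m'.+1 | p v == t) (v \notin greedy p s').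
  rewrite sum_lift_perm -big_split /= -card_Sn -sum1_card.
  by apply: eq_bigr => q _; case: (v \in _).
have matchedD : \sum_(v in D') \sum_(p : 'S_m'.+1 | p v == t) (v \notin greedy p s')
    <= \sum_(p : 'S_m'.+1) \sum_(w | p w == t) (w \notin greedy p s').
  rewrite (exchange_big_dep xpredT) //=; apply: leq_sum => p _.
  rewrite [leqRHS](bigID (mem D')) /=; apply: leq_trans (leq_addr _ _).
  by rewrite [leqRHS](eq_bigl (fun i => (i \in D') && (p i == t))) // => i; rewrite andbC.
have -> : #|D'| * m'.+1`! = m'.+1 * \sum_(v in D')
    (U v + \sum_(p : 'S_m'.+1 | p v == t) (v \notin greedy p s')).
  under eq_bigr do rewrite -fixed.
  by rewrite sum_nat_const factS mulnCA.
rewrite big_split mulnDr addnC; apply: leq_add; first by rewrite leq_mul2l matchedD orbT.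
rewrite big_distrr /=.
apply: (@leq_trans (\sum_(v in D') \sum_(p : 'S_m'.+1)
    (if mate p s' (c' v) is Some w then p w <= t else false))).
  by apply: leq_sum => v /moved.
by rewrite exchange_big; apply: leq_sum => p _; apply: matched.
Qed.

End LowerCount.

(** * Solving the recursion over ranks *)

Section GreedyLower.
Local Open Scope ring_scope.

(** With [N = #|D| * m!], [rank_count] reads [N <= m (X (t+1) - X t) + X (t+1)], that is
    [(m+1) (N - X (t+1)) <= m (N - X t)]: the deficit shrinks by [m/(m+1)] at each rank. *)
Lemma greedy_lower (K : realFieldType) m (s : seq {set 'I_m}) (D : {set 'I_m})
    (c : 'I_m -> nat) :
  {in D &, injective c} -> {in D, forall v, (c v < size s)%N} ->
  {in D, forall v, v \in nth set0 s (c v)} ->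
  #|D|%:R * (1 - (m%:R / m.+1%:R) ^+ m) <=
  (\sum_(p : 'S_m) #|~: greedy p s|)%N%:R / m`!%:R :> K.
Proof.
move=> c_inj c_lt c_mem.
pose X t := (\sum_(p : 'S_m) \sum_(w | p w < t) (w \notin greedy p s))%N.
have XS t : X t.+1 =
    (X t + \sum_(p : 'S_m) \sum_(w | p w == t :> nat) (w \notin greedy p s))%N.
  rewrite -big_split; apply: eq_bigr => p _ /=.
  rewrite (bigID (fun w => p w == t :> nat)) /= addnC; congr (_ + _)%N.
    by apply: eq_bigl => w; rewrite ltnS ltn_neqAle andbC.
  by apply: eq_bigl => w; rewrite ltnS andb_idl // => /eqP->.
have -> : (\sum_(p : 'S_m) #|~: greedy p s| = X m)%N.
  apply: eq_bigr => p _; rewrite card_matched.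
  by apply: eq_bigl => w; rewrite ltn_ord.
have fact0 : 0 < m`!%:R :> K by rewrite ltr0n fact_gt0.
have rec t : (t <= m)%N -> (#|D| * m`!)%:R - (X t)%:R <=
    (#|D| * m`!)%:R * (m%:R / m.+1%:R) ^+ t :> K.
  elim: t => [_|t IHt ltm].
    by rewrite expr0 mulr1 gerBl.
  have := IHt (ltnW ltm).
  have := rank_count c_inj c_lt c_mem (Ordinal ltm).
  have -> : (\sum_(p : 'S_m) \sum_(w | p w == Ordinal ltm) (w \notin greedy p s) =
     X t.+1 - X t)%N by rewrite XS addKn.
  change (\sum_(p : 'S_m) \sum_(w | (p w <= Ordinal ltm)%N) _)%N with (X t.+1).
  have XleS : (X t <= X t.+1)%N by rewrite XS leq_addr.
  rewrite -(ler_nat K) [X in _ <= X -> _]natrD [X in _ <= X + _ -> _]natrM natrB //.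
  set d := (_ * _)%:R; rewrite exprS => le1 le2.
  rewrite (mulrCA d) -mulrA mulrCA ler_pdivlMl ?ltr0n //.
  have : m%:R * (d - (X t)%:R) <= m%:R * (d * (m%:R / m.+1%:R) ^+ t).
    by rewrite ler_wpM2l.
  rewrite -[m.+1]addn1 natrD; lra.
rewrite ler_pdivlMr // mulrAC -natrM mulrBr mulr1 lerBlDr -lerBlDl.
exact: rec.
Qed.

End GreedyLower.

(** * The triangular instance *)

Section Equivariance.
Variables (m : nat) (tau : 'S_m).
Implicit Types (p : 'S_m) (A : {set 'I_m}) (s : seq {set 'I_m}).

(** The left factor acts first: [k] has under [tau * p] the rank of [tau k] under [p], hence the
    preimages. *)
Lemma best_permM p A k :
  (best (tau * p) (tau @^-1: A) == Some k) = (best p A == Some (tau k)).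
Proof.
apply/bestP/bestP => -[kA kmin]; rewrite inE in kA *; split=> // j jA.
  by have := kmin (tau^-1%g j); rewrite inE !permM permKV; apply.
by rewrite !permM kmin //; move: jA; rewrite inE.
Qed.

Lemma greedy_permM p s : all (fun A => tau @^-1: A == A) s ->
  greedy (tau * p) s = tau @^-1: greedy p s.
Proof.
elim/last_ind: s => [|s A IHs]; first by rewrite preimsetT.
rewrite all_rcons => /andP[/eqP tauA taus]; rewrite !greedy_rcons IHs //.
rewrite /greedy_step -{1}tauA -preimsetI.
case E: (best (_ * _) _) => [k|].
  move/eqP: E; rewrite best_permM => /eqP ->.
  by apply/setP => x; rewrite !inE (inj_eq perm_inj).
case E': (best p _) => [k|] //.
by have := best_permM p (A :&: greedy p s) (tau^-1%g k); rewrite permKV E E' eqxx.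
Qed.

(** The choice at time [i] depends only on the neighbourhoods seen so far, so invariance of that
    prefix is enough. *)
Lemma mate_permM p s i k : all (fun A => tau @^-1: A == A) (take i.+1 s) ->
  (i < size s)%N ->
  (mate (tau * p) s i == Some k) = (mate p s i == Some (tau k)).
Proof.
move=> + lti; rewrite (take_nth set0 lti) all_rcons => /andP[/eqP tauA taus].
by rewrite /mate greedy_permM // -[in LHS]tauA -preimsetI best_permM.
Qed.

End Equivariance.

(** For [n <= m], arrivals and offline vertices numbered [n] or more are isolated; they pad the
    triangle to [m] vertices on each side. *)
Definition triangular m n : seq {set 'I_m} :=
  mkseq (fun i => [set k : 'I_m | i <= k < n]) m.

Definition hits m n i (w : 'I_m) : nat :=
  \sum_(p : 'S_m) (mate p (triangular m n) i == Some w).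

Section Triangular.
Variables m n : nat.
Hypothesis le_nm : n <= m.

Local Notation hits := (@hits m n).

Lemma hits_sum_le i : \sum_w hits i w <= m`!.
Proof.
rewrite exchange_big /= -card_Sn -sum1_card; apply: leq_sum => p _.
case: mate => [k|]; last by rewrite big1.
rewrite (bigD1 k) //= eqxx big1 // => w wk.
by rewrite (inj_eq Some_inj) eq_sym (negPf wk).
Qed.

(** The transposition of [w] and [w'] fixes the neighbourhoods of arrivals [0] to [i], all of which
    contain both. *)
Lemma hits_sym i (w w' : 'I_m) : i < m -> i <= w < n -> i <= w' < n ->
  hits i w = hits i w'.
Proof.
move=> im wi wi'; rewrite /hits (reindex_inj (mulgI (tperm w w'))) /=.
apply: eq_bigr => p _; rewrite mate_permM ?size_mkseq // ?tpermL //.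
apply/(all_nthP set0) => j; rewrite size_takel ?size_mkseq // => ji.
rewrite nth_take // nth_mkseq; last by apply: leq_trans ji _.
apply/eqP/setP => x; rewrite !inE; case: tpermP => // ->; lia.
Qed.

Lemma hits_out i (w : 'I_m) : i < m -> ~~ (i <= w < n) -> hits i w = 0.
Proof.
move=> im out; apply: big1 => p _; case: bestP => // -[].
by rewrite !inE nth_mkseq // !inE (negPf out).
Qed.

Lemma hits_le i (w : 'I_m) : i < n -> (n - i) * hits i w <= m`!.
Proof.
move=> lein; have im : i < m by apply: leq_trans le_nm.
case: (boolP (i <= w < n)) => [wi|/hits_out->]; rewrite ?muln0 //.
apply: leq_trans (hits_sum_le i).
have card_range : #|[set k : 'I_m | i <= k < n]| = n - i.
  rewrite -[n - i]muln1 -sum_nat_const_nat (big_nat_widenl i 0) //.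
  by rewrite (big_nat_widen 0 n m) //= big_mkord -sum1_card; apply: eq_bigl => k; rewrite inE.
rewrite -card_range -sum_nat_const [leqRHS](bigID (mem [set k : 'I_m | i <= k < n])) /=.
apply: leq_trans (leq_addr _ _); apply: leq_sum => w'.
by rewrite inE => w'i; rewrite (hits_sym im wi w'i).
Qed.

Lemma triangular_hits :
  \sum_(p : 'S_m) #|~: greedy p (triangular m n)| = \sum_w \sum_(i < m) hits i w.
Proof.
rewrite (eq_bigr _ (fun p _ => card_matched p (triangular m n))).
rewrite exchange_big /=; apply: eq_bigr => w _.
by rewrite exchange_big /=; apply: eq_bigr => p _; rewrite notin_greedy size_mkseq.
Qed.

Lemma hits_total_le (w : 'I_m) : \sum_(i < m) hits i w <= m`!.
Proof.
rewrite exchange_big /= -card_Sn -sum1_card; apply: leq_sum => p _.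
have := notin_greedy p (triangular m n) w; rewrite size_mkseq => <-.
exact: leq_b1.
Qed.

Local Open Scope ring_scope.

(** Vertices [w < j] get the bound from [hits_le], those with [j <= w < n] the bound 1. Summing the
    former over [w] gives the sum over [i < j] of [(j-i)/(n-i) = 1 - (n-j)/(n-i)]. The cut [j] is
    left free. *)
Lemma triangular_upper (K : realFieldType) j : (j <= n)%N ->
  (\sum_(p : 'S_m) #|~: greedy p (triangular m n)|)%N%:R / m`!%:R <=
  n%:R - (n - j)%:R * \sum_(0 <= i < j) (n - i)%:R^-1 :> K.
Proof.
move=> lejn; rewrite triangular_hits.
have fact0 : 0 < m`!%:R :> K by rewrite ltr0n fact_gt0.
pose x w : K := if insub w is Some w' then (\sum_(i < m) hits i w')%N%:R / m`!%:R else 0.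
have -> : (\sum_w \sum_(i < m) hits i w)%N%:R / m`!%:R = \sum_(0 <= w < m) x w.
  rewrite big_mkord natr_sum mulr_suml; apply: eq_bigr => w _.
  by rewrite /x valK.
have x1 w : x w <= 1.
  rewrite /x; case: insub => [w'|]; last exact: ler01.
  by rewrite ler_pdivrMr // mul1r ler_nat hits_total_le.
have x0 w : (n <= w)%N -> x w = 0.
  move=> lew; rewrite /x; case: insubP => // w' _ /= ww'.
  rewrite big1 ?mul0r // => i _; apply: hits_out => //; lia.
have xH w : (w < n)%N -> x w <= \sum_(0 <= i < w.+1) (n - i)%:R^-1.
  move=> ltw; rewrite /x; case: insubP => [w' _ /= ww'|]; last first.
    by rewrite sumr_ge0 // => i _; rewrite invr_ge0.
  rewrite -(big_mkord predT (fun i => hits i w')) (big_cat_nat (n := w.+1)) //=; last lia.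
  have -> : (\sum_(w.+1 <= i < m) hits i w' = 0)%N.
    by rewrite big_nat big1 // => i /andP[wi im]; apply: hits_out => //; lia.
  rewrite addn0.
  rewrite natr_sum mulr_suml !big_nat; apply: ler_sum => i /andP[_ iw].
  rewrite ler_pdivrMr // ler_pdivlMl ?ltr0n; last lia.
  by rewrite -natrM ler_nat hits_le //; lia.
rewrite (big_cat_nat (n := n)) //=.
have -> : \sum_(n <= w < m) x w = 0.
  by rewrite big_nat big1 // => w /andP[/x0].
rewrite addr0.
rewrite (big_cat_nat (n := j)) //=.
have le1 : \sum_(j <= w < n) x w <= (n - j)%:R.
  by rewrite -sumr_const_nat; apply: ler_sum => w _.
have le2 : \sum_(0 <= w < j) x w <=
    j%:R - (n - j)%:R * \sum_(0 <= i < j) (n - i)%:R^-1.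
  elim: j lejn {le1} => [_|j IHj ltj]; first by rewrite !big_geq // mulr0 subr0.
  rewrite big_nat_recr //=; have := IHj (ltnW ltj); have := xH _ ltj.
  rewrite !(big_nat_recr j) //=.
  have nj : (n - j)%:R = (n - j.+1)%:R + 1 :> K by rewrite natr1; congr _%:R; lia.
  have nj0 : (n - j)%:R != 0 :> K by rewrite pnatr_eq0; lia.
  have : (n - j)%:R * (n - j)%:R^-1 = 1 :> K by rewrite divff.
  set y := (n - j)%:R^-1; rewrite nj -[j.+1]addn1 natrD; set S := \sum_(0 <= i < j) _.
  move=> h1 h2 h3; lra.
have -> : n%:R = j%:R + (n - j)%:R :> K by rewrite -natrD subnKC.
lra.
Qed.

End Triangular.

(** * Reduction to the greedy process *)

Section Simulation.
Variable n : nat.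
Local Notation m := (2 * n)%N.
Implicit Types (p : 'S_m) (G R : {set {set vertex n}}) (k l : 'I_m).

Lemma off_vertex_inj : injective (@off_vertex n).
Proof. by move=> k l []. Qed.

Lemma on_vertex_inj : injective (@on_vertex n).
Proof. by move=> k l []. Qed.

Lemma off_neq_on k l : (off_vertex k == on_vertex l) = false.
Proof. by []. Qed.

Lemma off_in_edge j k l : (off_vertex j \in [set off_vertex k; on_vertex l]) = (j == k).
Proof. by rewrite !inE off_neq_on orbF (inj_eq off_vertex_inj). Qed.

Lemma on_in_edge j k l : (on_vertex j \in [set off_vertex k; on_vertex l]) = (j == l).
Proof. by rewrite !inE eq_sym off_neq_on (inj_eq on_vertex_inj). Qed.

Lemma edge_inj k l k' l' :
  [set off_vertex k; on_vertex l] = [set off_vertex k'; on_vertex l'] -> (k, l) = (k', l').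
Proof.
move=> E; have := off_in_edge k k' l'; have := on_in_edge l k' l'.
by rewrite -E off_in_edge on_in_edge !eqxx => /esym/eqP-> /esym/eqP->.
Qed.

Definition offline_nbrs G l : {set 'I_m} := [set k | [set off_vertex k; on_vertex l] \in G].

Lemma neighbours_on G l : G \subset all_edges n ->
  neighbours G (on_vertex l) = [set off_vertex k | k in offline_nbrs G l].
Proof.
move=> /subsetP sub; apply/setP => x; rewrite inE; apply/idP/imsetP => [xG|[k]].
  have /imset2P[k l' _ _ E] := sub _ xG.
  have ll' : l = l' by apply/eqP; rewrite -(on_in_edge _ k) -E !inE eqxx.
  have xk : x = off_vertex k.
    by have := off_in_edge k k l'; rewrite -E !inE off_neq_on eqxx => /eqP.
  by exists k => //; rewrite inE -xk setUC.
by rewrite inE => kG ->; rewrite setUC.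
Qed.

(** The inverse appears because position [i] of the list holds the vertex of rank [i]. *)
Definition perm_seq p : seq (vertex n) :=
  [seq off_vertex (p^-1%g i) | i <- enum 'I_m].

Lemma index_perm_seq p k : index (off_vertex k) (perm_seq p) = p k.
Proof.
rewrite /perm_seq -[k in LHS](permK p) (index_map (f := fun i => off_vertex (p^-1%g i))).
  by rewrite index_enum_ord.
by move=> i j /off_vertex_inj/perm_inj.
Qed.

Lemma off_in_vertices R k l j :
  (off_vertex j \in vertices ([set off_vertex k; on_vertex l] |: R)) =
  (j == k) || (off_vertex j \in vertices R).
Proof.
by rewrite /vertices bigcup_setU big_set1 inE off_in_edge.
Qed.

(** Invariant of the simulation. Cardinals stay equal because the offline end of the added edge was
    free, which makes the edge new. *)
Lemma match_step_greedy G p R (F : {set 'I_m}) l : G \subset all_edges n ->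
  (forall k, (off_vertex k \in vertices R) = (k \notin F)) -> #|R| = #|~: F| ->
  let R' := match_step G (perm_seq p) R (on_vertex l) in
  let F' := greedy_step p F (offline_nbrs G l) in
  (forall k, (off_vertex k \in vertices R') = (k \notin F')) /\ #|R'| = #|~: F'|.
Proof.
move=> sub RF cRF /=; rewrite /match_step neighbours_on //.
have NE x : (x \in [set off_vertex k | k in offline_nbrs G l] :\: vertices R) =
    (x \in [set off_vertex k | k in offline_nbrs G l :&: F]).
  rewrite inE; apply/andP/imsetP => [[xR /imsetP[k kG xk]]|[k /setIP[kG kF] ->]].
    by exists k => //; rewrite inE kG; move: xR; rewrite xk RF negbK.
  by rewrite RF negbK kF; split=> //; apply/imset_f.
set N := _ :\: _ in NE *.
rewrite /greedy_step; case: pickP => [v0 v0N|N0]; last first.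
  case E: best => [k|] //; have /bestP[kN _] := introT eqP E.
  by have := N0 (off_vertex k); rewrite NE imset_f.
case: (arg_minnP (P := fun v => v \in N) _ v0N) => v.
rewrite {1}NE => /imsetP[k kN ->] vmin.
have -> : best p (offline_nbrs G l :&: F) = Some k.
  apply/eqP/bestP; split=> // j jN.
  have := vmin (off_vertex j); rewrite NE imset_f // => /(_ isT).
  by rewrite /rank !index_perm_seq ltnS.
have kF : k \in F by case/setIP: kN.
split=> [j|].
  by rewrite off_in_vertices RF !inE negb_and negbK.
rewrite cardsU1 cRF (_ : ~: (F :\ k) = k |: ~: F); last first.
  by apply/setP => j; rewrite !inE negb_and negbK.
rewrite cardsU1 inE kF; congr (_ + _)%N.
suff -> : [set off_vertex k; on_vertex l] \notin R by [].
apply/negP => eR; have := RF k; rewrite kF => /negP; apply.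
by apply/bigcupP; exists [set off_vertex k; on_vertex l] => //; rewrite off_in_edge.
Qed.

Lemma online_match_greedy G p (ls : seq 'I_m) : G \subset all_edges n ->
  #|online_match G (map (@on_vertex n) ls) (perm_seq p)| =
  #|~: greedy p (map (offline_nbrs G) ls)|.
Proof.
move=> sub.
suff [] : (forall k, (off_vertex k \in vertices
      (online_match G (map (@on_vertex n) ls) (perm_seq p))) =
      (k \notin greedy p (map (offline_nbrs G) ls))) /\
   #|online_match G (map (@on_vertex n) ls) (perm_seq p)| =
   #|~: greedy p (map (offline_nbrs G) ls)| by [].
elim/last_ind: ls => [|ls l [IH1 IH2]].
  split=> [k|]; first by rewrite /vertices big_set0 !inE.
  by rewrite cards0 /greedy /= setCT cards0.
rewrite !map_rcons greedy_rcons /online_match foldl_rcons.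
exact: match_step_greedy.
Qed.

(** Makes a uniform [sigma] a uniform [p]: [perm_seq] is injective into the permutations and both
    sides have [(2n)!] elements. *)
Lemma perms_of_offline :
  perm_eq (perms_of (offline n)) [seq perm_seq p | p <- enum 'S_m].
Proof.
have perm_seq_inj : injective perm_seq.
  move=> p q E; apply/permP => k; apply/val_inj => /=.
  by rewrite -index_perm_seq E index_perm_seq.
have uniqE : uniq [seq perm_seq p | p <- enum 'S_m] by rewrite map_inj_uniq ?enum_uniq.
rewrite perm_sym; apply: uniq_perm; rewrite ?permutations_uniq //.
apply: (uniq_min_size _ _ _).2 => //.
  move=> _ /mapP[p _ ->]; rewrite mem_permutations; apply: uniq_perm.
  - by rewrite map_inj_uniq ?enum_uniq // => i j /off_vertex_inj/perm_inj.
  - exact: enum_uniq.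
  move=> x; rewrite mem_enum; apply/mapP/imsetP => -[k _ ->]; last first.
    by exists (p k); rewrite ?mem_enum // permK.
  by exists (p^-1%g k).
rewrite size_map -cardE card_Sn size_permutations ?enum_uniq // -cardE.
by rewrite card_imset ?card_ord //; exact: off_vertex_inj.
Qed.

Local Open Scope ring_scope.

Lemma competitive_ratioE (K : realType) G ls : G \subset all_edges n -> (0 < n)%N ->
  competitive_ratio K G (map (@on_vertex n) ls) =
  (\sum_(p : 'S_m) #|~: greedy p (map (offline_nbrs G) ls)|)%N%:R / m`!%:R / #|diag_matching n|%:R.
Proof.
move=> sub n0; rewrite /competitive_ratio /pmf_expectation; congr (_ / _).
have sizeE : size (perms_of (offline n)) = m`!.
  by rewrite (perm_size perms_of_offline) size_map -cardE card_Sn.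
under eq_bigr do rewrite ffunE sizeE mulrAC.
rewrite -mulr_suml; congr (_ / _).
under eq_bigr do rewrite -sum1_count natr_sum big_mkcond mulr_suml /=.
rewrite exchange_big /= (perm_big _ perms_of_offline) big_map big_enum natr_sum.
apply: eq_bigr => p _.
rewrite (bigD1 (online_match G (map (@on_vertex n) ls) (perm_seq p))) //= eqxx mul1r.
rewrite online_match_greedy // big1 ?addr0 // => M.
by rewrite eq_sym => /negPf->; rewrite mul0r.
Qed.

Lemma card_diag_matching : #|diag_matching n| = n.
Proof.
rewrite card_in_imset; last by move=> k l _ _ /edge_inj[].
rewrite -[RHS]subn0 -[RHS]muln1 -sum_nat_const_nat (big_nat_widen 0 n m) ?leq_pmull //.
by rewrite big_mkord -sum1_card; apply: eq_bigl => k; rewrite inE.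
Qed.

(** Instance of [greedy_lower] where [D] is the set of indices below [n] and [c] the position in the
    arrival order; the diagonal edges provide the partners. *)
Lemma competitive_ratio_lower (K : realType) G pi : (0 < n)%N ->
  G \in Gamma n -> pi \in Pi n ->
  1 - (m%:R / m.+1%:R) ^+ m <= competitive_ratio K G pi.
Proof.
move=> n0; rewrite inE powersetE => /andP[sub /and3P[_ dG _]].
rewrite mem_permutations => pi_perm.
have -> : pi = map (@on_vertex n) (map snd pi).
  rewrite -map_comp map_id_in // => x; rewrite (perm_mem pi_perm) mem_enum.
  by case/imsetP => k _ ->.
have in_ls k : k \in map snd pi.
  apply/mapP; exists (on_vertex k) => //.
  by rewrite (perm_mem pi_perm) mem_enum imset_f.
set ls := map snd pi in in_ls *.
rewrite competitive_ratioE // card_diag_matching ler_pdivlMr ?ltr0n //.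
have cardD : #|[set k : 'I_m | (k < n)%N]| = n.
  by rewrite -[RHS]card_diag_matching card_in_imset // => k l _ _ /edge_inj[].
rewrite [leLHS]mulrC.
have := @greedy_lower K m (map (offline_nbrs G) ls) [set k : 'I_m | (k < n)%N] (index^~ ls).
rewrite cardD; apply.
- by move=> k l _ _ E; rewrite -(nth_index k (in_ls k)) E nth_index.
- by move=> k _; rewrite size_map index_mem.
move=> k; rewrite inE => kn; rewrite (nth_map k) ?index_mem // nth_index // inE.
by apply: (subsetP dG); apply/imsetP; exists k; rewrite ?inE.
Qed.

Definition triangle : {set {set vertex n}} :=
  [set [set off_vertex kl.1; on_vertex kl.2] | kl : 'I_m * 'I_m
    & (kl.2 <= kl.1 < n)%N].

Lemma in_triangle k l :
  ([set off_vertex k; on_vertex l] \in triangle) = (l <= k < n)%N.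
Proof.
apply/imsetP/idP => [[[k' l']]|lk]; first by rewrite inE /= => lk /edge_inj[-> ->].
by exists (k, l); rewrite ?inE.
Qed.

Lemma triangle_sub : triangle \subset all_edges n.
Proof. by apply/subsetP => _ /imsetP[[k l] _ ->]; apply: imset2_f. Qed.

(** Maximality: the edges of a matching have distinct offline ends, all among the first [n]; [f]
    picks that end. *)
Lemma triangle_Gamma : triangle \in Gamma n.
Proof.
rewrite inE powersetE triangle_sub /=; apply/and3P; split.
- apply/andP; split.
    by apply/forall_inP => _ /imsetP[k _ ->]; rewrite cards2 off_neq_on.
  apply/trivIsetP => _ _ /imsetP[k _ ->] /imsetP[l _ ->] kl.
  have {}kl : k != l by apply: contraNneq kl => ->.
  rewrite -setI_eq0; apply/eqP/setP => x; rewrite !inE.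
  apply/negP => /andP[/orP[]/eqP-> /orP[]]; rewrite ?off_neq_on ?(inj_eq off_vertex_inj).
  + by rewrite (negPf kl).
  + by [].
  + by rewrite eq_sym off_neq_on.
  by rewrite (inj_eq on_vertex_inj) (negPf kl).
- by apply/subsetP => _ /imsetP[k + ->]; rewrite inE in_triangle leqnn.
apply/forallP => M; apply/implyP => /andP[/andP[_ /trivIsetP triv] /subsetP sub].
pose f (e : {set vertex n}) := [pick k : 'I_m | (k < n)%N && (off_vertex k \in e)].
have fP e : e \in M -> exists k, [/\ f e = Some k, (k < n)%N & off_vertex k \in e].
  move=> /sub /imsetP[[k l]]; rewrite inE /= => lk ->; rewrite /f.
  case: pickP => [k' /andP[]|/(_ k)]; first by exists k'.
  by rewrite off_in_edge eqxx andbT; case/andP: lk => _ ->.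
have f_inj : {in M &, injective f}.
  move=> e e' eM e'M; have [k [-> _ ke]] := fP e eM.
  have [k' [-> _ ke']] := fP e' e'M => -[kk']; rewrite -kk' in ke'.
  apply/eqP/negP => /negP ee'; have := triv e e' eM e'M ee'.
  by rewrite disjoint_subset => /subsetP/(_ _ ke); rewrite inE ke'.
rewrite -(card_in_imset f_inj) [leqRHS]card_in_imset; last by move=> k l _ _ /edge_inj[].
rewrite -[leqRHS](card_imset _ Some_inj); apply/subset_leq_card/subsetP => _ /imsetP[e eM ->].
by have [k [-> kn _]] := fP e eM; rewrite imset_f // inE.
Qed.

Definition in_order : seq (vertex n) := map (@on_vertex n) (enum 'I_m).

Lemma in_order_Pi : in_order \in Pi n.
Proof.
rewrite mem_permutations; apply: uniq_perm; rewrite ?enum_uniq //.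
  by rewrite map_inj_uniq ?enum_uniq //; exact: on_vertex_inj.
move=> x; rewrite mem_enum; apply/mapP/imsetP => -[k _ ->]; exists k => //.
by rewrite mem_enum.
Qed.

Lemma competitive_ratio_triangle (K : realType) r : (0 < n)%N -> (r <= n)%N ->
  competitive_ratio K triangle in_order <=
  (n%:R - r%:R * \sum_(0 <= i < n - r) (n - i)%:R^-1) / n%:R.
Proof.
move=> n0 rn; rewrite competitive_ratioE ?triangle_sub // card_diag_matching.
rewrite ler_pM2r ?invr_gt0 ?ltr0n //.
have -> : map (offline_nbrs triangle) (enum 'I_m) = triangular m n.
  rewrite /triangular /mkseq -val_enum_ord -map_comp; apply: eq_map => l.
  by apply/setP => k; rewrite !inE in_triangle.
by have := @triangular_upper m n (@leq_pmull n 2 isT) K (n - r) (leq_subr _ _); rewrite subKn.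
Qed.

End Simulation.

(** * The limit *)

Local Open Scope classical_set_scope.
Local Open Scope ring_scope.

Section Bounds.
Variable K : realType.

(** The quotient is the telescoping product of the [1 + 1/(n-i)], and [ln (1 + x) <= x]. *)
Lemma harmonic_tail_ge_ln n j : (j <= n)%N ->
  ln (n.+1%:R / (n - j).+1%:R) <= \sum_(0 <= i < j) (n - i)%:R^-1 :> K.
Proof.
elim: j => [_|j IHj ltj]; first by rewrite subn0 divff ?pnatr_eq0 // ln1 big_geq.
rewrite big_nat_recr //= subnSK //.
have nj0 : 0 < (n - j)%:R :> K by rewrite ltr0n subn_gt0.
have -> : n.+1%:R / (n - j)%:R =
    n.+1%:R / (n - j).+1%:R * (1 + (n - j)%:R^-1) :> K.
  rewrite -[(n - j).+1]addn1 natrD; field.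
  by rewrite gt_eqF //= gt_eqF // ltr_wpDr.
rewrite lnM ?posrE ?divr_gt0 ?addr_gt0 ?ltr0n ?invr_gt0 //.
apply: lerD; first exact: IHj (ltnW ltj).
by rewrite le_ln1Dx // (lt_trans _ (_ : 0 < _)) ?invr_gt0 // ltrN10.
Qed.

Lemma Q_upper n : (0 < n)%N -> Q K n <= 1 - 1 / expR 1 + 2 / n%:R.
Proof.
move=> n0; rewrite /Q /seq_min.
have n0K : 0 < n%:R :> K by rewrite ltr0n.
pose e : K := expR 1; have e0 : 0 < e by exact: expR_gt0.
have e1 : 1 <= e by rewrite -[1]expR0 ler_expR.
(* The gain [r * ln (n/r)] is largest at [r = n/e], where the logarithm is 1. *)
pose r := Num.truncn (n%:R / e).
have /andP[r_le r_gt] : r%:R <= n%:R / e < r.+1%:R.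
  by apply: Num.Theory.truncn_itv; rewrite divr_ge0 // ltW.
have rn : (r <= n)%N.
  by rewrite -(ler_nat K) (le_trans r_le) // ler_pdivrMr // ler_peMr // ltW.
apply: (@bigmin_inf_seq _ _ _ _ _ (competitive_ratio K (triangle n) (in_order n))) => //.
  by apply: allpairs_f; rewrite ?mem_enum ?triangle_Gamma ?in_order_Pi.
apply: le_trans (competitive_ratio_triangle K n0 rn) _.
have tail : 1 - e / n%:R <= \sum_(0 <= i < n - r) (n - i)%:R^-1 :> K.
  apply: le_trans (harmonic_tail_ge_ln (leq_subr r n)); rewrite subKn //.
  have en0 : 0 < 1 + e / n%:R by rewrite addr_gt0 // divr_gt0.
  have : ln (1 + e / n%:R) <= e / n%:R.
    by apply: le_ln1Dx; rewrite (lt_trans _ (divr_gt0 e0 n0K)) // ltrN10.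
  move=> h; apply: (@le_trans _ _ (ln (e / (1 + e / n%:R)))).
    by rewrite ln_div ?posrE // {1}/e expRK lerD2l lerN2.
  rewrite ler_ln ?posrE ?divr_gt0 //.
  rewrite ler_pdivrMr // mulrAC ler_pdivlMr ?ltr0n //.
  have : e * r%:R <= n%:R by rewrite mulrC -ler_pdivlMr.
  rewrite -[r.+1]addn1 -[n.+1]addn1 !natrD.
  have -> : (n%:R + 1) * (1 + e / n%:R) = n%:R + 1 + e + e / n%:R :> K.
    by field; rewrite gt_eqF.
  have : 0 <= e / n%:R by rewrite divr_ge0 // ltW.
  lra.
rewrite ler_pdivrMr //.
have -> : (1 - 1 / expR 1 + 2 / n%:R) * n%:R = n%:R - n%:R / e + 2.
  by rewrite /e; field; rewrite !gt_eqF ?expR_gt0.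
have : r%:R * (1 - e / n%:R) <= r%:R * \sum_(0 <= i < n - r) (n - i)%:R^-1.
  by rewrite ler_wpM2l.
have : r%:R * (e / n%:R) <= 1.
  by rewrite mulrA ler_pdivrMr // mul1r -ler_pdivlMr.
(* The constant 2 collects 1 from rounding [n/e] down and 1 from [r * (e/n) <= 1]. *)
move: r_gt; rewrite -[r.+1]addn1 natrD mulrBr; lra.
Qed.

Lemma Q_lower n : (0 < n)%N -> 1 - ((2 * n)%:R / (2 * n).+1%:R) ^+ (2 * n) <= Q K n.
Proof.
move=> n0; rewrite /Q /seq_min.
set s := [seq _ | _ <- _, _ <- _].
have s_ge x : x \in s -> 1 - ((2 * n)%:R / (2 * n).+1%:R) ^+ (2 * n) <= x.
  case/allpairsP => -[G pi] /= [GG pp ->].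
  by apply: competitive_ratio_lower => //; rewrite -mem_enum.
(* Since [s] is nonempty, the head that starts [seq_min] is one of its members, not the default
   0. *)
have : competitive_ratio K (triangle n) (in_order n) \in s.
  by apply: allpairs_f; rewrite ?mem_enum ?triangle_Gamma ?in_order_Pi.
case: s s_ge => // x s s_ge _ /=; rewrite big_seq.
by apply: le_bigmin => [|i /s_ge //]; rewrite s_ge ?mem_head.
Qed.

End Bounds.

Theorem theorem4 (K : realType) :
  cvgn (Q K) -> Q K n @[n --> \oo] --> 1 - 1 / expR 1.
Proof.
move=> _.
(* [harmonic n] is [1/(n+1)]. Below, [1 + x <= expR x] at [x = -1/(2n+1)] bounds the power by
   [expR (-1 + 1/(2n+1))]; above, [2/n <= 4/(n+1)] for [n >= 1]. *)
apply: (@squeeze_cvgr _ _ _ _ (fun n => 1 - expR (-1 + harmonic n))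
  (fun n => 1 - 1 / expR 1 + 4 * harmonic n)).
- near=> n; have n0 : (0 < n)%N by near: n; exact: nbhs_infty_gt.
  have n0K : 0 < n%:R :> K by rewrite ltr0n.
  apply/andP; split.
    apply: le_trans (Q_lower K n0); rewrite lerD2l lerN2.
    have -> : (2 * n)%:R / (2 * n).+1%:R = 1 - (2 * n).+1%:R^-1 :> K.
      by rewrite -[(2 * n).+1]addn1 natrD; field; rewrite gt_eqF // ltr_wpDl.
    apply: (@le_trans _ _ (expR (- (2 * n).+1%:R^-1) ^+ (2 * n))).
      apply: lerXn2r; rewrite ?nnegrE ?expR_ge0 //; last exact: expR_ge1Dx.
      by rewrite subr_ge0 invf_le1 ?ltr0n // ler1n.
    rewrite -expRM_natl ler_expR /harmonic /=.
    have -> : (2 * n)%:R * - (2 * n).+1%:R^-1 = - 1 + (2 * n).+1%:R^-1 :> K.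
      rewrite -[(2 * n).+1]addn1 natrD; field; rewrite gt_eqF // ltr_wpDl.
    by rewrite lerD2l lef_pV2 ?posrE ?ltr0n // ler_nat ltnS leq_pmull.
  apply: le_trans (Q_upper K n0) _; rewrite lerD2l /harmonic /=.
  rewrite ler_pdivrMr // mulrAC ler_pdivlMr ?ltr0n //.
  have : 1 <= n%:R :> K by rewrite ler1n.
  rewrite -[n.+1]addn1 natrD; lra.
- rewrite div1r -expRN -[X in - expR X]addr0.
  apply: cvgB; first exact: cvg_cst.
  apply: continuous_cvg; first exact: continuous_expR.
  by apply: cvgD; [exact: cvg_cst|exact: cvg_harmonic].
rewrite -[X in _ --> X]addr0 -(mulr0 4).
by apply: cvgD; [exact: cvg_cst|apply: cvgMr; exact: cvg_harmonic].
Unshelve. all: by end_near.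
Qed.
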